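(* Let $X$ be a projective scheme over $\mathbb Z$. Let $\overline{\mathcal L}=(\mathbb V_X(\mathcal L),T)$ be a seminormed line bundle on $X$ such that the underlying line bundle is very ample over $\mathbb Z$. Let $i:Y\to X$ be a hyperplane section with respect to $\mathcal L$. Let $(D_YX,\overline{\mathcal L'})$ be the deformation to the projective completion of the cone associated to $(X,Y,\overline{\mathcal L})$. Consider the natural transverse action of $\mathbb G_m$ on $\mathbb V_{D_YX}(\mathcal L')$. Then the analytic tube $T'$ associated to $\overline{\mathcal L'}$ is stable by the restriction of this action to $U(1)$, the group of complex numbers of modulus $1$.
   Context: **Seminormed line bundles and tubes.** Let $X$ be a projective scheme over $\mathbb Z$. A seminormed line bundle $\overline{\mathcal L}=(\mathcal L,|\cdot|)$ on $X$ is a line bundle $\mathcal L$ with a seminorm $|\cdot|_x$ on each complex line $\mathcal L_{|x}$ ($x\in X(\mathbb C)$), invariant under complex conjugation, such that for every open $U$ of the analytic space $X_{\mathbb C}$ and $s\in H^0(U,\mathcal L)$ the function $x\mapsto |s(x)|_x$ is upper semicontinuous. Put $\mathbb V_X(\mathcal L)=\mathrm{Spec}_X\bigoplus_{n\ge0}\mathcal L^{\otimes n}$ (total space of $\mathcal L^\vee$); its complex points are pairs $(x,\varphi)$, $x\in X(\mathbb C)$, $\varphi\in\mathcal L^\vee_{|x}$. The analytic tube of $\overline{\mathcal L}$ is the compact set $T=\{(x,\varphi): |\varphi|_x\le 1\}$, $|\varphi|_x$ the dual (possibly infinite) norm. Giving a seminorm is equivalent to giving a compact $T\subset\mathbb V_X(\mathcal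 L)(\mathbb C)$ containing the zero section, stable under fiberwise multiplication by $\lambda$, $|\lambda|\le1$, and under complex conjugation; one writes $\overline{\mathcal L}=(\mathbb V_X(\mathcal L),T)$. The holomorphically convex hull of a compact $K$ in $\mathbb V_X(\mathcal L)(\mathbb C)$ is $\widehat K=\{z:|f(z)|\le\sup_K|f|\text{ for all holomorphic }f\text{ on }\mathbb V_X(\mathcal L)(\mathbb C)\}$. **Deformation.** Let $\mathcal L$ be very ample over $\mathbb Z$, $S_\bullet=\bigoplus_{n\ge0} H^0(X,\mathcal L^{\otimes n})$. A closed immersion $i:Y\to X$ is a *hyperplane section with respect to $\mathcal L$* if the graded ideal $I_\bullet\subset S_\bullet$ associated to $i$ is generated in degree 1. Write $\mathbb P^1=\mathrm{Proj}\,\mathbb Z[u,t]$, $0=\{u=0\}$, $\infty=\{t=0\}$, $1=[1:1]$. $D_YX\to\mathbb P^1$ is obtained by gluing $X\times\mathrm{Spec}\,\mathbb Z[u/t]$ over $\{u\ne\infty\}$ with $\mathrm{Proj}\,S'_\bullet$ over $\{u\neq0\}$, where $S'_\bullet=\bigoplus_{l\in\mathbb Z}I_\bullet^l(t/u)^{-l}$ ($I_\bullet^l=S_\bullet$ for $l\le0$; grading induced from $S_\bullet$), via the canonical identification of both with $X\times(\mathbb A^1-\{0\})$ over $\{u\ne0,\infty\}$. Let $t_1,\dots,t_M\in H^0(X,\mathcal L)$ generate $I_\bullet$ and $s_0,\dots,s_N\in H^0(X,\mathcal L)$ induce a closed immersion $X\to\mathbb P^N$. The map $(x,u)\mapsto([s_0(x):\dots:s_N(x):ut_1(x):\dots:ut_M(x)],[u:1])$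 from $X\times\mathbb A^1$ to $\mathbb P^{N+M}\times\mathbb P^1$ extends to $D_YX$, and $\mathcal L'$ is the pullback to $D_YX$ of $\mathcal O(1)\boxtimes\mathcal O(1)$ (independent of choices, ample over $\mathbb Z$, with fiber over $1$ equal to $(X,\mathcal L)$). The *natural transverse action* of $\mathbb G_m$ on $D_YX$ and $\mathbb V_{D_YX}(\mathcal L')$ is induced by $([x_0:\dots:x_{N+M}],[u:t])\mapsto([x_0:\dots:x_N:\lambda x_{N+1}:\dots:\lambda x_{N+M}],[\lambda u:t])$ on $\mathbb P^{N+M}\times\mathbb P^1$ and $\mu(x_0,\dots,x_{N+M})\otimes(u,t)\mapsto\mu(x_0,\dots,x_N,\lambda x_{N+1},\dots,\lambda x_{N+M})\otimes(\lambda u,t)$ on $\mathbb V(\mathcal O(1)\boxtimes\mathcal O(1))$. Let $K$ be the union of the zero section of $\mathbb V_{D_YX}(\mathcal L')(\mathbb C)$ and the orbit $U(1)\cdot T$ of $T\subset\mathbb V_X(\mathcal L)(\mathbb C)=\mathbb V_{D_YX}(\mathcal L')_{|1}(\mathbb C)$ under the natural transverse action restricted to $U(1)$. Set $T'=\widehat K$ (holomorphically convex hull in $\mathbb V_{D_YX}(\mathcal L')(\mathbb C)$) and $\overline{\mathcal L'}=(\mathbb V_{D_YX}(\mathcal L'),T')$; $(D_YX,\overline{\mathcal L'})$ is the deformation to the projective completion of the cone associated to $(X,Y,\overline{\mathcal L})$. *)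

(* Defs.v *)
From HB Require Import structures.
From mathcomp Require Import all_boot all_order all_algebra.
From mathcomp Require Import complex.
From mathcomp Require Import all_classical all_reals all_analysis.
From mathcomp Require Import ring.

Set Implicit Arguments.
Unset Strict Implicit.
Unset Printing Implicit Defensive.

Import Order.TTheory GRing.Theory Num.Theory.
Import numFieldNormedType.Exports.

Local Open Scope classical_set_scope.
Local Open Scope ring_scope.

(* The alias makes the topology that MathComp-Analysis puts on every
   numFieldType available on R[i]. *)
Definition Cx (R : realType) : numClosedFieldType := R[i]%C.

Definition modulus (R : realType) (z : Cx R) : R := Normc.normc z.

(** * Projective schemes over Z with a very ample line bundle *)

Record gradedRing := GradedRing {
  gr_ring :> comPzRingType;
  homog : nat -> set gr_ring;
  homog0 : forall n, homog n 0;
  homogB : forall n a b, homog n a -> homog n b -> homog n (a - b);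
  homog_one : homog 0 1;
  homogM : forall m n a b, homog m a -> homog n b -> homog (m + n) (a * b);
  homog_span : forall a, exists n (c : nat -> gr_ring),
    (forall i, homog i (c i)) /\ a = \sum_(i < n) c i;
  homog_free : forall n (c : nat -> gr_ring), (forall i, homog i (c i)) ->
    \sum_(i < n) c i = 0 -> forall i, (i < n)%N -> c i = 0
}.

(* A closed subscheme X = Proj A of P^N over Z, where A = pcoord X is the
   quotient of Z[x_0, ..., x_N] by a homogeneous ideal.  Every pair of a
   projective scheme over Z and a very ample line bundle is of the form
   (X, O(1)), the pvar X i being the sections defining the immersion. *)
Record projScheme (N : nat) := ProjScheme {
  pcoord : gradedRing;
  pvar : 'I_N.+1 -> pcoord;
  pvar_homog : forall i, homog 1 (pvar i);
  pvar_gen : forall P : set pcoord,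
    P 1 -> (forall a b, P a -> P b -> P (a - b)) ->
    (forall a b, P a -> P b -> P (a * b)) ->
    (forall i, P (pvar i)) -> forall a, P a
}.

(* The graded ring S = \bigoplus_(n >= 0) H^0(X, O(n)), computed on the
   covering of X by the open sets {x_i != 0}: A -> S becomes bijective after
   inverting any x_i, S is separated, and compatible families of local
   sections g_i / x_i^k glue.  (All local sections may be given the same
   denominator exponent k, and, increasing k, their compatibility may be
   written in A itself.)  In general A -> S is neither injective nor
   surjective. *)
Record sectionRing (N : nat) (X : projScheme N) := SectionRing {
  sec_ring :> gradedRing;
  res : {rmorphism pcoord X -> sec_ring};
  res_homog : forall n a, homog n a -> homog n (res a);
  res_ker : forall a, res a = 0 -> forall i, exists m, pvar X i ^+ m * a = 0;
  sec_separated : forall s : sec_ring,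
    (forall i, exists m, res (pvar X i) ^+ m * s = 0) -> s = 0;
  sec_local : forall n (s : sec_ring), homog n s ->
    forall i, exists m (a : pcoord X),
      homog (n + m) a /\ res (pvar X i) ^+ m * s = res a;
  sec_glue : forall n k (g : 'I_N.+1 -> pcoord X),
    (forall i, homog (n + k) (g i)) ->
    (forall i j, pvar X j ^+ k * g i = pvar X i ^+ k * g j) ->
    exists2 s : sec_ring, homog n s &
      forall i, res (pvar X i) ^+ k * s = res (g i)
}.

Record closedSubscheme (N : nat) (X : projScheme N) := ClosedSubscheme {
  sub_ideal : set (pcoord X);
  sub_ideal0 : sub_ideal 0;
  sub_idealD : forall a b, sub_ideal a -> sub_ideal b -> sub_ideal (a + b);
  sub_idealM : forall a b, sub_ideal b -> sub_ideal (a * b);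
  sub_ideal_homog : forall n (c : nat -> pcoord X),
    (forall i, homog i (c i)) -> sub_ideal (\sum_(i < n) c i) ->
    forall i, (i < n)%N -> sub_ideal (c i)
}.

Section Ideals.
Variables (N : nat) (X : projScheme N) (S : sectionRing X).
Variable Y : closedSubscheme X.

(* The graded ideal I of S of all sections whose restriction to Y is zero. *)
Definition graded_ideal : set S := [set s | forall i, exists m b,
  sub_ideal Y b /\ res S (pvar X i) ^+ m * s = res S b].

Definition hyperplane_section : Prop := forall s, graded_ideal s ->
  exists n (t b : 'I_n -> S),
    (forall k, homog 1 (t k) /\ graded_ideal (t k)) /\
    s = \sum_(k < n) t k * b k.

Definition degree1_generators (M : nat) (t : 'I_M -> S) : Prop :=
  (forall j, homog 1 (t j) /\ graded_ideal (t j)) /\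
  (forall s, graded_ideal s -> exists b : 'I_M -> S, s = \sum_j t j * b j).

Fixpoint ideal_pow (l : nat) : set S :=
  if l is l'.+1 then
    [set s | exists n (a b : 'I_n -> S),
       (forall k, graded_ideal (a k) /\ ideal_pow l' (b k)) /\
       s = \sum_(k < n) a k * b k]
  else setT.

Definition ideal_powz (l : int) : set S :=
  if l is Posz n then ideal_pow n else setT.

End Ideals.

(** * Holomorphic functions in coordinates *)

Section Coordinates.
Variables (R : realType) (P : Type).
Local Notation C := (Cx R).

Definition eval_coord n (e : 'I_n -> P -> C) (p : P) : 'rV[C]_n :=
  \row_k e k p.

(* D is a set of complex points of an affine scheme on which the functions in
   E generate the regular functions.  The analytic topology of D is the
   coarsest one for which E consists of continuous functions, and a function
   is holomorphic when it is locally the restriction of a holomorphic function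
   of finitely many elements of E. *)
Definition coord_nbhd (D : set P) (E : set (P -> C)) (p : P) (A : set P) :=
  exists n (e : 'I_n -> P -> C) (U : set 'rV[C]_n),
    [/\ forall k, E (e k), open U, U (eval_coord e p) &
        forall q, D q -> U (eval_coord e q) -> A q].

Definition coord_holomorphic (D : set P) (E : set (P -> C)) (f : P -> C) :=
  forall p, D p ->
  exists n (e : 'I_n -> P -> C) (U : set 'rV[C]_n) (h : 'rV[C]_n -> C),
    [/\ forall k, E (e k), open U, U (eval_coord e p),
        forall x, U x -> differentiable h x &
        forall q, D q -> U (eval_coord e q) -> f q = h (eval_coord e q)].

Definition holo_hull (V : set P) (holo : set (P -> C)) (K : set P) : set P :=
  [set z | V z /\ forall f, holo f ->
     ((modulus (f z))%:E <= ereal_sup [set (modulus (f k))%:E | k in K])%E].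

End Coordinates.

(** * Complex points of X and of the total space of the dual of O(1) *)

Section Seminorm.
Variables (R : realType) (N : nat) (X : projScheme N) (S : sectionRing X).
Local Notation C := (Cx R).

(* A complex point x of X = Proj S with a trivialisation of the line O(1)_x is
   the same as a ring morphism phi : S -> C that does not kill S_+ : phi s is
   the value of s at x in the induced trivialisation of O(n)_x.  Changing the
   trivialisation multiplies phi by mu^n on S_n. *)
Definition cone : set (S -> C) := [set phi |
  [/\ GRing.zmod_morphism phi, GRing.monoid_morphism phi &
      exists n s, [/\ (0 < n)%N, homog n s & phi s != 0]]].

Definition rescaled (mu : C) (phi phi' : S -> C) : Prop :=
  forall n s, homog n s -> phi' s = mu ^+ n * phi s.

Definition cone_coord : set ((S -> C) -> C) :=
  range (fun (s : S) (phi : S -> C) => phi s).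

(* The preimage in the cone of an open subset of the analytic space X_C. *)
Definition open_cone (U : set (S -> C)) : Prop :=
  [/\ U `<=` cone,
      forall mu phi phi', mu != 0 -> U phi -> cone phi' ->
        rescaled mu phi phi' -> U phi' &
      forall phi, U phi -> coord_nbhd cone cone_coord phi U].

Definition line_section (U : set (S -> C)) (sigma : (S -> C) -> C) : Prop :=
  (forall mu phi phi', mu != 0 -> U phi -> U phi' -> rescaled mu phi phi' ->
     sigma phi' = mu * sigma phi) /\
  coord_holomorphic U cone_coord sigma.

(* nrm phi a is the seminorm of the vector of O(1)_x whose coordinate in the
   trivialisation phi is a. *)
Record seminorm := Seminorm {
  nrm :> (S -> C) -> C -> R;
  nrm_ge0 : forall phi a, cone phi -> 0 <= nrm phi a;
  nrmD : forall phi a b, cone phi -> nrm phi (a + b) <= nrm phi a + nrm phi b;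
  nrmZ : forall phi b a, cone phi -> nrm phi (b * a) = modulus b * nrm phi a;
  nrm_rescaled : forall mu phi phi' a, mu != 0 -> cone phi -> cone phi' ->
    rescaled mu phi phi' -> nrm phi' (mu * a) = nrm phi a;
  nrm_conj : forall phi a, cone phi ->
    nrm (fun s => Num.conj (phi s)) (Num.conj a) = nrm phi a;
  nrm_usc : forall U sigma, open_cone U -> line_section U sigma ->
    forall phi (r : R), U phi -> nrm phi (sigma phi) < r ->
      coord_nbhd U cone_coord phi [set phi' | nrm phi' (sigma phi') < r]
}.

Variable L : seminorm.

Definition dual_norm (phi : S -> C) (c : C) : \bar R :=
  ereal_sup [set (modulus (c * a))%:E | a in [set a | L phi a <= 1]].

(* The pair (phi, c) stands for the linear form on O(1)_x that multiplies the
   coordinate in the trivialisation phi by c. *)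
Definition tube : set ((S -> C) * C) :=
  [set p | cone p.1 /\ (dual_norm p.1 p.2 <= 1)%E].

End Seminorm.

(** * Deformation to the projective completion of the cone *)

Section Deformation.
Variables (R : realType) (N : nat) (X : projScheme N) (S : sectionRing X).
Variables (Y : closedSubscheme X) (M : nat) (t : 'I_M -> S).
Local Notation C := (Cx R).
Local Notation Ipow := (ideal_powz Y).

(* A ring morphism psi from S' = \bigoplus_l I^l (t/u)^(-l) to C, given by
   psi l a = psi (a (t/u)^(-l)) for a in I^l, and not killing S'_+.  Outside
   I^l the value of psi l is irrelevant. *)
Definition rees_cone : set (int -> S -> C) := [set psi |
  [/\ forall l a b, Ipow l a -> Ipow l b -> psi l (a - b) = psi l a - psi l b,
      forall l m a b, Ipow l a -> Ipow m b ->
        psi (l + m) (a * b) = psi l a * psi m b,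
      psi 0 1 = 1 &
      exists n l a, [/\ (0 < n)%N, homog n a, Ipow l a & psi l a != 0]]].

Definition rees_rescaled (mu : C) (psi psi' : int -> S -> C) : Prop :=
  forall n l a, homog n a -> Ipow l a -> psi' l a = mu ^+ n * psi l a.

(* The morphism S' -> C induced by phi : S -> C and the value v of u/t. *)
Definition rees_of (phi : S -> C) (v : C) : int -> S -> C :=
  fun l a => phi a * v ^ l.

(* Complex points of the total space V_D(L') over D = D_Y X.
   PtT phi v mu lies over the point (phi, [v : 1]) of X x {t != 0}, and
   PtU psi mu over the point psi of Proj S', which is sent to
   [1 : psi(t/u)] in P^1.  In both cases mu is the coefficient of the point
   mu (x_0, ..., x_(N+M)) (x) (u, t) of V(O(1) (x) O(1)), see [tensor]. *)
Inductive bundle_point : Type :=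
| PtT of (S -> C) & C & C
| PtU of (int -> S -> C) & C.

Definition total_space : set bundle_point := [set z |
  match z with
  | PtT phi _ _ => cone phi
  | PtU psi _ => rees_cone psi
  end].

Definition homog_coords (x : S -> C) (y : S -> C) : 'cV[C]_(N.+1 + M) :=
  col_mx (\col_i x (res S (pvar X i))) (\col_j y (t j)).

Definition P1_coords (u t : C) : 'rV[C]_2 :=
  \row_k (if k == ord0 then u else t).

Definition tensor (z : bundle_point) : 'M[C]_(N.+1 + M, 2) :=
  match z with
  | PtT phi v mu =>
      mu *: (homog_coords phi (fun s => v * phi s) *m P1_coords v 1)
  | PtU psi mu =>
      mu *: (homog_coords (psi 0) (psi 1) *m P1_coords 1 (psi (- 1) 1))
  end.

Definition same_base (z z' : bundle_point) : Prop :=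
  match z, z' with
  | PtT phi v _, PtT phi' v' _ =>
      v = v' /\ exists2 mu, mu != 0 & rescaled mu phi phi'
  | PtU psi _, PtU psi' _ =>
      exists2 mu, mu != 0 & rees_rescaled mu psi psi'
  | PtT phi v _, PtU psi _ | PtU psi _, PtT phi v _ =>
      v != 0 /\ exists2 mu, mu != 0 & rees_rescaled mu (rees_of phi v) psi
  end.

(* Equality of the points of V_D(L') represented by z and z' : as L' is the
   pullback of O(1) (x) O(1), V_D(L') is the fibre product of D and
   V(O(1) (x) O(1)). *)
Definition same_point (z z' : bundle_point) : Prop :=
  same_base z z' /\ tensor z = tensor z'.

Definition coordsT : set ((S -> C) * C * C -> C) :=
  range (fun (s : S) (p : (S -> C) * C * C) => p.1.1 s) `|`
  [set (fun p => p.1.2)] `|` [set (fun p => p.2)].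

Definition coordsU : set ((int -> S -> C) * C -> C) :=
  [set e | exists l (a : S), Ipow l a /\ e = (fun p => p.1 l a)] `|`
  [set (fun p => p.2)].

(* The representatives form a principal C^*-bundle over each of the two open
   charts of V_D(L'), so that a function on V_D(L') is holomorphic if and only
   if its pullbacks to these two bundles are. *)
Definition holomorphic (f : bundle_point -> C) : Prop :=
  [/\ forall z z', total_space z -> total_space z' -> same_point z z' ->
        f z = f z',
      coord_holomorphic [set p | cone p.1.1] coordsT
        (fun p => f (PtT p.1.1 p.1.2 p.2)) &
      coord_holomorphic [set p | rees_cone p.1] coordsU
        (fun p => f (PtU p.1 p.2))].

(* The natural transverse action; [tensor_act] and [same_point_act] show that
   it is induced by [ambient_act]. *)
Definition act (lam : C) (z : bundle_point) : bundle_point :=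
  match z with
  | PtT phi v mu => PtT phi (lam * v) mu
  | PtU psi mu => PtU (fun l a => lam ^ l * psi l a) (lam * mu)
  end.

Definition ambient_act (lam : C) (w : 'M[C]_(N.+1 + M, 2)) :
    'M[C]_(N.+1 + M, 2) :=
  \matrix_(i, k) ((if (i < N.+1)%N then 1 else lam) *
                  (if k == ord0 then lam else 1) * w i k).

Lemma total_space_act lam z :
  lam != 0 -> total_space z -> total_space (act lam z).
Proof.
move=> lam0; case: z => [phi v mu|psi mu] //= [psiB psiM psi1 [n [l [a]]]].
move=> [n0 na la an0]; split => [k b c kb kc|k m b c kb mc||].
- by rewrite psiB// mulrBr.
- by rewrite psiM// expfzDr// mulrACA.
- by rewrite psi1 expr0z mulr1.
- by exists n, l, a; split=> //; rewrite mulf_neq0// expfz_neq0.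
Qed.

Lemma tensor_act lam z :
  lam != 0 -> tensor (act lam z) = ambient_act lam (tensor z).
Proof.
move=> lam0; case: z => [phi v mu|psi mu]; apply/matrixP => i k;
  rewrite !mxE !big_ord1 !mxE; case: splitP => j _; rewrite !mxE;
  case: ifP => _; rewrite ?expr0z ?expr1z ?exprN1.
all: by field.
Qed.

Lemma same_point_act lam z z' :
  lam != 0 -> same_point z z' -> same_point (act lam z) (act lam z').
Proof.
move=> lam0 [zz' tzz']; split; last by rewrite !tensor_act// tzz'.
have reesE phi v l a : rees_of phi (lam * v) l a = lam ^ l * rees_of phi v l a.
  by rewrite /rees_of expfzMl mulrCA.
case: z z' zz' {tzz'} => [phi v c|psi c] [phi' v' c'|psi' c'] /=.
- by move=> [-> ?].
- move=> [v0 [mu mu0 h]]; split; first by rewrite mulf_neq0.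
  by exists mu => // n l a na la; rewrite (h n)// reesE mulrCA.
- move=> [v0 [mu mu0 h]]; split; first by rewrite mulf_neq0.
  by exists mu => // n l a na la; rewrite (h n)// reesE mulrCA.
- by move=> [mu mu0 h]; exists mu => // n l a na la; rewrite (h n)// mulrCA.
Qed.

(* The fibre of (D, L') at u/t = 1 is (X, L). *)
Definition fiber_one (p : (S -> C) * C) : bundle_point := PtT p.1 1 p.2.

Definition zero_section : set bundle_point := [set z | total_space z /\
  match z with PtT _ _ mu | PtU _ mu => mu = 0 end].

Variable L : seminorm R S.

Definition generating_compact : set bundle_point := zero_section `|`
  [set z | total_space z /\ exists lam p,
     [/\ `|lam| = 1, tube L p & same_point z (act lam (fiber_one p))]].

Definition deformed_tube : set bundle_point :=
  holo_hull total_space holomorphic generating_compact.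

End Deformation.

(* Main.v *)
(* T' is the hull of K.  The transverse action of lam, |lam| = 1, maps K into
   itself, and precomposition with it preserves holomorphic functions because
   it multiplies every coordinate function by a constant.  Hence, for z in T'
   and f holomorphic, |f (lam z)| is at most the supremum over K of |f o lam|,
   which is at most the supremum over K of |f|. *)
Require Import Defs.
From mathcomp Require Import all_boot all_order all_algebra.
From mathcomp Require Import all_classical all_reals all_analysis.
Import Order.TTheory GRing.Theory Num.Theory.
Import numFieldNormedType.Exports.
Local Open Scope classical_set_scope.
Local Open Scope ring_scope.

(** Column [j] is multiplied by the scalar [d 0 j], so the preimage of a box of entrywise
    neighbourhoods is again such a box. *)
Lemma mulmx_diag_continuous (K : numFieldType) (m n : nat) (d : 'rV[K]_n) :
  continuous (fun x : 'M[K]_(m, n) => x *m diag_mx d).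
Proof.
move=> x A [P nP PA].
exists (fun i j => (fun y : K => y * d 0 j) @^-1` P i j) => [i j|y Py].
  apply: (@mulrr_continuous _ (d 0 j) (x i j)).
  by move: (nP i j); rewrite mul_mx_diag mxE.
apply: PA => i j.
by rewrite mul_mx_diag mxE; exact: Py.
Qed.

Lemma mulmx_diag_differentiable (K : numFieldType) (m n : nat) (d : 'rV[K]_n)
    (x : 'M[K]_(m.+1, n)) :
  differentiable (fun y : 'M[K]_(m.+1, n) => y *m diag_mx d) x.
Proof.
exact: (@linear_differentiable _ _ _ (mulmxr (diag_mx d)))
  (@mulmx_diag_continuous _ _ _ d).
Qed.

(** The coordinates [e] that serve near [g p] also serve near [p]: in them [g] becomes a diagonal
    linear map [s], so the local model [h] on [U] is replaced by [h \o s] on the preimage of [U]. *)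
Lemma coord_holomorphic_comp_scale (R : realType) (P : Type) (D : set P)
    (E : set (P -> Cx R)) (g : P -> P) (f : P -> Cx R) :
  (forall p, D p -> D (g p)) ->
  (forall e, E e -> exists c, forall p, e (g p) = c * e p) ->
  coord_holomorphic D E f -> coord_holomorphic D E (f \o g).
Proof.
move=> gD gE fhol p Dp.
have [n [e [U [h [eE Uo Up hd fE]]]]] := fhol _ (gD _ Dp).
have /choice[d dE] k := gE _ (eE k).
pose s (x : 'rV[Cx R]_n) := x *m diag_mx (\row_k d k).
have sE q : eval_coord e (g q) = s (eval_coord e q).
  by apply/rowP => k; rewrite /s mul_mx_diag !mxE dE mulrC.
exists n, e, (s @^-1` U), (h \o s); split => //.
- by apply: open_comp => // x _; exact: mulmx_diag_continuous.
- by rewrite /= -sE.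
- move=> x Ux; apply: differentiable_comp; last exact: hd.
  exact: mulmx_diag_differentiable.
- by move=> q Dq Uq /=; rewrite fE ?sE//; exact: gD.
Qed.

Section TransverseAction.
Context {R : realType} {N : nat} {X : projScheme N} {S : sectionRing X}.
Variables (Y : closedSubscheme X) (M : nat) (t : 'I_M -> S).
Local Notation bpt := (bundle_point R S).

Lemma act_comp (lam lam' : Cx R) (z : bpt) :
  lam != 0 -> lam' != 0 -> act lam (act lam' z) = act (lam * lam') z.
Proof.
move=> lam0 lam'0; case: z => [phi v mu|psi mu] /=; rewrite mulrA//.
congr PtU; apply/funext => l; apply/funext => a.
by rewrite mulrA expfzMl.
Qed.

(** In the chart [PtT] only [v] is scaled, by [lam]. In the chart [PtU] the coordinate of weight [l]
    is scaled by [lam ^ l] and the fibre coordinate by [lam]. *)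
Lemma holomorphic_act (lam : Cx R) (f : bpt -> Cx R) :
  lam != 0 -> holomorphic Y t f -> holomorphic Y t (f \o act lam).
Proof.
move=> lam0 [f_wd fT fU]; split.
- move=> z z' Vz Vz' zz'.
  apply: f_wd; [exact: total_space_act..|exact: same_point_act].
- apply: (@coord_holomorphic_comp_scale _ _ _ _
    (fun p => (p.1.1, lam * p.1.2, p.2)) _ _ _ fT) => // e.
  move=> [[[s _ <-]|->]|->].
  + by exists 1 => p; rewrite mul1r.
  + by exists lam.
  + by exists 1 => p; rewrite mul1r.
- apply: (@coord_holomorphic_comp_scale _ _ _ _
    (fun p => (fun l a => lam ^ l * p.1 l a, lam * p.2)) _ _ _ fU).
    (* Twisting by [lam ^ l] keeps [psi] a nonzero multiplicative family on the Rees algebra. *)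
    by move=> p Dp; exact: (@total_space_act _ _ _ _ Y lam (PtU p.1 p.2)).
  move=> e [[l [a [_ ->]]]|->]; last by exists lam.
  by exists (lam ^ l).
Qed.

Lemma generating_compact_act (L : seminorm R S) (lam : Cx R) (z : bpt) :
  `|lam| = 1 -> generating_compact Y t L z ->
  generating_compact Y t L (act lam z).
Proof.
move=> lam1.
have lam0 : lam != 0 by rewrite -normr_gt0 lam1 ltr01.
move=> [[Vz z0]|[Vz [lam' [p [lam'1 Tp zp]]]]].
- left; split; first exact: total_space_act.
  (* The fibre coordinate is fixed in one chart and multiplied by [lam] in the other, so it stays
     zero. *)
  by case: z z0 {Vz} => [phi v mu|psi mu] //= ->; rewrite mulr0.
- right; split; first exact: total_space_act.
  (* If [z] represents the translate of [p] by [lam'], then [act lam z] represents its translate by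
     [lam * lam'], again of modulus 1. *)
  exists (lam * lam'), p; split => //; first by rewrite normrM lam1 lam'1 mulr1.
  rewrite -act_comp//; first exact: same_point_act.
  by rewrite -normr_gt0 lam'1 ltr01.
Qed.

End TransverseAction.

Theorem proposition6p4 (R : realType) (N : nat) (X : projScheme N)
    (S : sectionRing X) (L : seminorm R S)
    (Y : closedSubscheme X) (hY : hyperplane_section S Y)
    (M : nat) (t : 'I_M -> S) (ht : degree1_generators Y t) :
  forall lam : Cx R, `|lam| = 1 ->
  forall z : bundle_point R S, deformed_tube Y t L z -> deformed_tube Y t L (act lam z).
Proof.
move=> lam lam1 z [Vz hullz].
have lam0 : lam != 0 by rewrite -normr_gt0 lam1 ltr01.
split=> [|f fhol]; first exact: total_space_act.
apply: le_trans (hullz _ (holomorphic_act Y M t lam f lam0 fhol)) _.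
apply: ge_ereal_sup => _ [k Kk <-].
(* The value of [f \o act lam] at [k] is the value of [f] at [act lam k], again a point of the
   generating compact. *)
apply: ereal_sup_ubound; exists (act lam k) => //.
exact: generating_compact_act.
Qed.
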